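(* Let $\mathcal{V}$ be a vector space over a field $\mathbb{F}$, let $\mathcal{D}:\mathcal{V}\to\mathcal{V}$ be a linear endomorphism, and let $$P=(\mathcal{D}+\lambda_0)^{p_0}(\mathcal{D}+\lambda_1)^{p_1}\cdots(\mathcal{D}+\lambda_\ell)^{p_\ell}:\mathcal{V}\to\mathcal{V},$$ with $\lambda_0,\ldots,\lambda_\ell\in\mathbb{F}$ mutually distinct and $p_i\in\mathbb{Z}_{\ge1}$. Then $$\mathcal{R}(P)=\bigcap_{i=0}^{\ell}\mathcal{R}\big((\mathcal{D}+\lambda_i)^{p_i}\big),\qquad \mathcal{N}(P)=\bigoplus_{i=0}^{\ell}\mathcal{N}\big((\mathcal{D}+\lambda_i)^{p_i}\big).$$
   Context: For a linear operator $A:\mathcal{V}\to\mathcal{V}$, $\mathcal{R}(A)$ denotes its image and $\mathcal{N}(A)$ its kernel. The direct sum is an internal direct sum of subspaces of $\mathcal{V}$. *)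

(* Defs.v *)
From mathcomp Require Import all_boot all_order all_algebra.
From mathcomp Require Import boolp classical_sets.

Set Implicit Arguments.
Unset Strict Implicit.
Unset Printing Implicit Defensive.

Import GRing.Theory.
Local Open Scope classical_set_scope.
Local Open Scope ring_scope.

Definition shift_op (F : fieldType) (V : lmodType F) (D : {linear V -> V})
  (a : F) : V -> V := D \+ a \*: idfun.

(* A product of operators is a composite, the leftmost factor being applied
   last. *)
Definition shift_prod (F : fieldType) (V : lmodType F) (D : {linear V -> V})
  (l : nat) (lam : 'I_l.+1 -> F) (p : 'I_l.+1 -> nat) : V -> V :=
  \big[comp/idfun]_(i < l.+1) iter (p i) (shift_op D (lam i)).

Definition kernel (U V : zmodType) (f : U -> V) : set U := [set u | f u = 0].

(* Membership in a [set V] is made boolean by classical logic, which is what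
   lets [submod_closed] apply to possibly undecidable subspaces. *)
Definition internal_direct_sum (F : fieldType) (V : lmodType F) (I : finType)
  (W : set V) (N : I -> set V) : Prop :=
  [/\ forall i, submod_closed (mem (N i)),
      W = [set \sum_i v i | v in [set v : I -> V | forall i, N i (v i)]]
    & forall v w : I -> V,
        (forall i, N i (v i)) -> (forall i, N i (w i)) ->
        \sum_i v i = \sum_i w i -> forall i, v i = w i].

(* Main.v *)
Require Import Defs.
From HB Require Import structures.
From mathcomp Require Import all_boot all_order all_algebra.
From mathcomp Require Import boolp classical_sets.

Set Implicit Arguments.
Unset Strict Implicit.
Unset Printing Implicit Defensive.

Import GRing.Theory.
Local Open Scope classical_set_scope.
Local Open Scope ring_scope.

(** The operator [P] is the polynomial [\prod_i q_i] evaluated at [D], where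
    [q_i = ('X + lam_i)^p_i].  Evaluation at [D] makes [V] a module over
    [{poly F}], so both equalities follow from arithmetic in [{poly F}].  As the
    [lam_i] are distinct, the [q_i] are pairwise coprime, and the Chinese
    remainder theorem writes
      [1 = \sum_i u_i * Q_i + r * Q],   [Q = \prod_i q_i],   [Q_i = Q / q_i]
    ([coprime_family_bezout]).  Each summand [u_i * Q_i] acts on the kernel of
    [Q] as the projection onto the kernel of [q_i] along the other kernels, which
    gives existence and uniqueness of the decomposition
    ([kernel_prod_direct_sum]).  If [v = q_i x_i] for every [i], then
    [u_i Q_i v = Q (u_i x_i)], so that [v = Q (\sum_i u_i x_i + r v)]
    ([range_prod_bigcap]). *)

(** * Pairwise coprime families of polynomials *)

Section CoprimeFamily.
Variables (F : fieldType) (I : finType) (q : I -> {poly F}).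
Hypothesis q_coprime : forall i j, i != j -> coprimep (q i) (q j).

Let cofactor i := \prod_(j | j != i) q j.

Lemma prod_cofactor i : \prod_j q j = q i * cofactor i.
Proof. by rewrite (bigD1 i). Qed.

Lemma coprimep_prodr (p : {poly F}) (s : seq I) (P : pred I) :
  (forall j, P j -> coprimep p (q j)) -> coprimep p (\prod_(j <- s | P j) q j).
Proof.
move=> cop; elim/big_rec: _ => [|j r Pj IH]; first exact: coprimep1.
by rewrite coprimepMr cop.
Qed.

(** Gauss's lemma, one factor at a time: each factor is coprime to the product
    of the later ones because the enumeration has no repetition. *)
Lemma prod_coprime_dvdp (p : {poly F}) :
  (forall i, q i %| p) -> \prod_i q i %| p.
Proof.
move=> dvd_q; rewrite -big_enum; elim: (enum I) (enum_uniq I) => [|i s IH] /=.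
  by rewrite big_nil dvd1p.
case/andP=> s'i s_uniq; rewrite big_cons Gauss_dvdp ?dvd_q ?IH //.
rewrite big_seq; apply: coprimep_prodr => j sj; apply: q_coprime.
by apply: contraNneq s'i => ->.
Qed.

(** The multiple [r] of the whole product is kept so that the identity also
    holds for the empty family, for which the sum vanishes. *)
Lemma coprime_family_bezout : exists (u : I -> {poly F}) (r : {poly F}),
  1 = \sum_i u i * cofactor i + r * \prod_i q i.
Proof.
(* [u i] is an inverse of the [i]-th cofactor modulo [q i]. *)
have inv_mod i : exists u, q i %| 1 - u * cofactor i.
  have /Bezout_eq1_coprimepP[[a b] /= ab1] : coprimep (q i) (cofactor i).
    by apply: coprimep_prodr => j ij; apply: q_coprime; rewrite eq_sym.
  by exists b; rewrite -ab1 addrK dvdp_mull.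
have [u uP] := choice inv_mod; exists u.
suff /dvdpP[r rP] : \prod_i q i %| 1 - \sum_i u i * cofactor i.
  by exists r; rewrite -rP addrC subrK.
apply: prod_coprime_dvdp => i.
rewrite (bigD1 i) //= opprD addrA dvdp_sub ?uP //.
elim/big_ind: _ => [|a b|j ji]; [exact: dvdp0 | exact: dvdp_add |].
by rewrite /cofactor (bigD1 i) 1?eq_sym //= dvdp_mull ?dvdp_mulr.
Qed.

End CoprimeFamily.

(** * Evaluation of polynomials at an endomorphism *)

Section PolyAction.
Variables (F : fieldType) (V : lmodType F) (D : {linear V -> V}).

Definition polyact (q : {poly F}) (v : V) : V :=
  \sum_(i < size q) q`_i *: iter i D v.

Lemma iter_is_linear n : linear (iter n D).
Proof. by move=> a u v; elim: n => //= n ->; rewrite linearP. Qed.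

Lemma polyact_is_linear q : linear (polyact q).
Proof.
move=> a u v; rewrite /polyact scaler_sumr -big_split /=.
apply: eq_bigr => i _; rewrite iter_is_linear scalerDr !scalerA.
by rewrite [q`_i * a]mulrC.
Qed.

HB.instance Definition _ q :=
  GRing.isLinear.Build F V V *:%R (polyact q) (polyact_is_linear q).

(** A common summation bound for several polynomials allows their actions to
    be compared coefficientwise. *)
Lemma polyact_widen n (q : {poly F}) v : (size q <= n)%N ->
  polyact q v = \sum_(i < n) q`_i *: iter i D v.
Proof.
move=> le_qn; rewrite /polyact.
rewrite (big_ord_widen n (fun i => q`_i *: iter i D v)) // big_mkcond /=.
apply: eq_bigr => i _; case: ltnP => // le_qi.
by rewrite nth_default ?scale0r.
Qed.

Lemma polyactD q r v : polyact (q + r) v = polyact q v + polyact r v.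
Proof.
pose n := maxn (size q) (size r).
rewrite (@polyact_widen n (q + r)) ?size_polyD //.
rewrite (@polyact_widen n q) ?leq_maxl // (@polyact_widen n r) ?leq_maxr //.
by rewrite -big_split; apply: eq_bigr => i _; rewrite coefD scalerDl.
Qed.

Lemma polyactC c v : polyact c%:P v = c *: v.
Proof.
by rewrite (@polyact_widen 1) ?size_polyC_leq1 // big_ord1 coefC eqxx.
Qed.

Lemma polyact1 v : polyact 1 v = v.
Proof. by rewrite polyactC scale1r. Qed.

Lemma polyact_sum (I : finType) (q : I -> {poly F}) v :
  polyact (\sum_i q i) v = \sum_i polyact (q i) v.
Proof.
by apply: (big_morph (polyact^~ v)) => [a b|]; rewrite ?polyactD ?polyactC ?scale0r.
Qed.

Lemma polyactMX q v : polyact (q * 'X) v = D (polyact q v).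
Proof.
rewrite (@polyact_widen (size q).+1) ?size_polyMX_leq //; last first.
  by apply: leq_trans (size_polyMleq _ _) _; rewrite size_polyX addn2.
rewrite big_ord_recl coefMX scale0r add0r linear_sum.
by apply: eq_bigr => i _; rewrite coefMX linearZ.
Qed.

Lemma polyactX v : polyact 'X v = D v.
Proof. by rewrite -['X]mul1r polyactMX polyact1. Qed.

(** Composition of operators becomes multiplication of polynomials, so the
    operators [polyact q] commute with one another. *)
Lemma polyactM q r v : polyact (q * r) v = polyact q (polyact r v).
Proof.
elim/poly_ind: q => [|q c IH]; first by rewrite mul0r !polyactC !scale0r.
rewrite mulrDl mulrAC !polyactD !polyactMX IH polyactC; congr (_ + _).
(* Associativity for a constant factor is linearity in the polynomial. *)
rewrite mul_polyC (@polyact_widen (size r)) ?size_scale_leq // scaler_sumr.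
by apply: eq_bigr => i _; rewrite coefZ scalerA.
Qed.

Lemma polyact_prod n (q : 'I_n -> {poly F}) :
  polyact (\prod_i q i) = \big[comp/idfun]_(i < n) polyact (q i).
Proof.
elim/big_rec2: _ => [|i f r _ <-]; apply/funext => v /=.
  exact: polyact1.
exact: polyactM.
Qed.

Lemma iter_shift_op a n :
  iter n (shift_op D a) = polyact (('X + a%:P) ^+ n).
Proof.
apply/funext => v; elim: n => [|n IH] /=; first by rewrite expr0 polyact1.
by rewrite IH exprS polyactM polyactD polyactC polyactX.
Qed.

Lemma kernel_submod_closed q : submod_closed (mem (kernel (polyact q))).
Proof.
split=> [|a u v]; rewrite !inE /kernel /=; first exact: linear0.
by move=> qu qv; rewrite linearP /= qu qv scaler0 addr0.
Qed.

Section Product.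
Variables (I : finType) (q : I -> {poly F}).
Hypothesis q_coprime : forall i j, i != j -> coprimep (q i) (q j).

(** For a vector killed by the product the last term vanishes, and the other
    terms are its components; for any vector the last term lies in the range of
    the product. *)
Lemma bezout_decomposition : exists (u : I -> {poly F}) (r : {poly F}),
  forall v, v = \sum_i polyact (u i * \prod_(j | j != i) q j) v
                + polyact (r * \prod_i q i) v.
Proof.
have [u [r bezout]] := coprime_family_bezout q_coprime; exists u, r => v.
by rewrite -polyact_sum -polyactD -bezout polyact1.
Qed.

(** Since [v] is in every range, the factor missing from the [i]-th cofactor is
    supplied by a preimage of [v] under the [i]-th operator. *)
Lemma range_prod_bigcap :
  range (polyact (\prod_i q i)) = \bigcap_i range (polyact (q i)).
Proof.
apply/seteqP; split=> [_ [v _ <-] i _|v range_v].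
  by rewrite (prod_cofactor _ i) polyactM; eexists.
have /choice[x xP] i : exists x, polyact (q i) x = v.
  by have [x _ <-] := range_v i Logic.I; exists x.
have [u [r bezout]] := bezout_decomposition.
exists (\sum_i polyact (u i) (x i) + polyact r v) => //.
rewrite linearD linear_sum /= [RHS]bezout.
congr (_ + _); last by rewrite -!polyactM mulrC.
apply: eq_bigr => i _; rewrite -[in RHS](xP i) -!polyactM.
by rewrite (prod_cofactor _ i) mulrC [q i * _]mulrC mulrA.
Qed.

(** The operators [proj i] of the proof are the projections of the
    decomposition: [proj i] maps the kernel of the product into the [i]-th
    kernel, kills the other ones because its cofactor contains their
    polynomials, and fixes the [i]-th one because the [proj j] sum to the
    identity. *)
Lemma kernel_prod_direct_sum :
  internal_direct_sum (kernel (polyact (\prod_i q i)))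
    (fun i => kernel (polyact (q i))).
Proof.
have [u [r bezout]] := bezout_decomposition.
pose proj i := polyact (u i * \prod_(j | j != i) q j).
have ker_prod i v : kernel (polyact (q i)) v ->
    polyact (\prod_j q j) v = 0.
  by move=> qv; rewrite (prod_cofactor _ i) mulrC polyactM qv linear0.
have sum_proj v : polyact (\prod_j q j) v = 0 -> \sum_i proj i v = v.
  by move=> Qv; rewrite [RHS]bezout polyactM Qv linear0 addr0.
have proj_other i j v : j != i -> kernel (polyact (q j)) v -> proj i v = 0.
  move=> ji qv; rewrite /proj (bigD1 j) //= mulrCA mulrC polyactM.
  by rewrite qv linear0.
have proj_same i v : kernel (polyact (q i)) v -> proj i v = v.
  move=> qv; rewrite -[RHS]sum_proj ?(ker_prod i) //.
  rewrite (bigD1 i) //= big1 ?addr0 // => j ji.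
  by apply: proj_other qv; rewrite eq_sym.
have proj_sum i (v : I -> V) : (forall j, kernel (polyact (q j)) (v j)) ->
    proj i (\sum_j v j) = v i.
  move=> qv; rewrite /proj linear_sum -/(proj i) (bigD1 i) //= -[RHS]addr0.
  congr (_ + _); first exact: proj_same.
  by apply: big1 => j ji; apply: proj_other (qv j).
split.
- by move=> i; apply: kernel_submod_closed.
- apply/seteqP; split=> [v Qv|_ [v qv <-]].
    exists (proj ^~ v); last exact: sum_proj.
    move=> i; rewrite /kernel /= /proj -polyactM mulrCA -prod_cofactor.
    by rewrite polyactM Qv linear0.
  by rewrite /kernel /= linear_sum big1 // => i _; apply: ker_prod (qv i).
- by move=> v w qv qw eq_vw i; rewrite -(proj_sum i v qv) eq_vw proj_sum.
Qed.

End Product.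
End PolyAction.

(** * Powers of shifts by distinct scalars *)

Lemma coprimep_XaddC (F : fieldType) (a b : F) (m n : nat) : a != b ->
  coprimep (('X + a%:P) ^+ m) (('X + b%:P) ^+ n).
Proof.
move=> ab; apply/coprimep_expl/coprimep_expr.
rewrite -[a]opprK -[b]opprK (polyCN (- a)) (polyCN (- b)).
by rewrite coprimep_XsubC root_XsubC eqr_opp eq_sym.
Qed.

Theorem corollary1p3 (F : fieldType) (V : lmodType F) (D : {linear V -> V})
    (l : nat) (lam : 'I_l.+1 -> F) (p : 'I_l.+1 -> nat)
    (lam_inj : injective lam) (p_ge1 : forall i, (1 <= p i)%N) :
  range (shift_prod D lam p) =
    \bigcap_i range (iter (p i) (shift_op D (lam i)))
  /\ internal_direct_sum (kernel (shift_prod D lam p))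
       (fun i => kernel (iter (p i) (shift_op D (lam i)))).
Proof.
pose q i : {poly F} := ('X + (lam i)%:P) ^+ p i.
have prodE : shift_prod D lam p = polyact D (\prod_i q i).
  by rewrite polyact_prod; apply: eq_bigr => i _; apply: iter_shift_op.
have q_coprime i j : i != j -> coprimep (q i) (q j).
  by move=> ij; apply: coprimep_XaddC; rewrite (inj_eq lam_inj).
rewrite prodE; split.
  rewrite (range_prod_bigcap D q_coprime).
  by apply: eq_bigcapr => i _; rewrite iter_shift_op.
have -> : (fun i => kernel (iter (p i) (shift_op D (lam i)))) =
          fun i => kernel (polyact D (q i)).
  by apply/funext => i; rewrite iter_shift_op.
exact: kernel_prod_direct_sum.
Qed.
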